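(* In the set $\mathcal{Q}$ with the product $\wedge_{\mathcal{Q}}$, the time-like basis elements satisfy $$\mathbf{e}_i \wedge_{\mathcal{Q}} \mathbf{e}_i = \mathbf{e}_j \wedge_{\mathcal{Q}} \mathbf{e}_j = \mathbf{e}_k \wedge_{\mathcal{Q}} \mathbf{e}_k = \mathbf{e}_i \wedge_{\mathcal{Q}} \mathbf{e}_j \wedge_{\mathcal{Q}} \mathbf{e}_k = -1 .$$
   Context: Let $V$ be the real three-dimensional space with basis $\mathbf{e}_i,\mathbf{e}_j,\mathbf{e}_k$ (labels ordered $i<j<k$), all three time-like: the dot product is the bilinear form with $\mathbf{e}_p\cdot\mathbf{e}_q=\Delta_{pq}$, where $\Delta_{ii}=\Delta_{jj}=\Delta_{kk}=-1$ and $\Delta_{pq}=0$ for $p\neq q$. Let $\mathcal{Q}$ be the real vector space of all objects $Q=a+b\,\mathbf{e}_i+c\,\mathbf{e}_j+d\,\mathbf{e}_k$ with $a,b,c,d\in\mathbb{R}$ (a scalar part $a$ plus a vector part in $V$). The vector product $\wedge_{\mathrm{vec}}$ is the bilinear product on $V$ with $\mathbf{e}_p\wedge_{\mathrm{vec}}\mathbf{e}_q=\sigma(pq,r)\,\mathbf{e}_r$ when $\{p,q,r\}=\{i,j,k\}$, where $\sigma(pq,r)$ is the sign of the permutation sorting $(p,q,r)$ into $(i,j,k)$, and $\mathbf{e}_p\wedge_{\mathrm{vec}}\mathbf{e}_p=0$; in coordinates it is the usual cross product of $\mathbb{R}^3$. The product on $\mathcal{Q}$ is $Q_1\wedge_{\mathcal{Q}}Q_2=Q_1\cdot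 Q_2+Q_1\wedge_{\mathrm{vec}}Q_2$, the first term being the scalar part and the second the vector part. Explicitly, for $P=p_0+\mathbf{p}$ and $Q=q_0+\mathbf{q}$ with $p_0,q_0\in\mathbb{R}$, $\mathbf{p},\mathbf{q}\in V$: the scalar part is $P\cdot Q=p_0q_0+\mathbf{p}\cdot\mathbf{q}$ (scalars and vectors being orthogonal) and the vector part is $P\wedge_{\mathrm{vec}}Q=q_0\mathbf{p}+p_0\mathbf{q}+\mathbf{p}\wedge_{\mathrm{vec}}\mathbf{q}$. The triple product may be read as $(\mathbf{e}_i\wedge_{\mathcal{Q}}\mathbf{e}_j)\wedge_{\mathcal{Q}}\mathbf{e}_k$. *)

(* Defs.v *)
From mathcomp Require Import all_boot all_order all_algebra all_fingroup.
From mathcomp Require Import reals.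

Set Implicit Arguments.
Unset Strict Implicit.
Unset Printing Implicit Defensive.

Import Order.TTheory GRing.Theory Num.Theory.
Local Open Scope ring_scope.

(* The labels i < j < k are the elements 0 < 1 < 2 of 'I_3. *)
Definition li : 'I_3 := inord 0.
Definition lj : 'I_3 := inord 1.
Definition lk : 'I_3 := inord 2.

(* V is R^3 as row vectors, with e_i, e_j, e_k the standard basis. *)
Definition vbase (R : realType) (p : 'I_3) : 'rV[R]_3 := delta_mx 0 p.

Definition Delta (R : realType) (p q : 'I_3) : R := if p == q then -1 else 0.

Definition vdot (R : realType) (u v : 'rV[R]_3) : R :=
  \sum_p \sum_q u 0 p * v 0 q * Delta R p q.

(* The sum has exactly one term when p, q, r are distinct, namely the sign of
   the permutation sorting (p, q, r) into (i, j, k), and is empty otherwise. *)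
Definition sigma (R : realType) (p q r : 'I_3) : R :=
  \sum_(s : 'S_3 | [&& s p == li, s q == lj & s r == lk]) (-1) ^+ s.

(* On basis vectors this is sigma(pq, r) e_r, with r the third label, and 0 if
   p = q, since sigma vanishes unless the three labels are distinct. *)
Definition vwedge (R : realType) (u v : 'rV[R]_3) : 'rV[R]_3 :=
  \sum_p \sum_q (u 0 p * v 0 q) *: \sum_r sigma R p q r *: vbase R r.

(* The pair (a, v) is a + v; R^o is R as a vector space over itself, so that
   qspace R is an lmodType over R. *)
Definition qspace (R : realType) := (R^o * 'rV[R]_3)%type.

Definition qscal (R : realType) (a : R) : qspace R := (a, 0).
Definition qvect (R : realType) (v : 'rV[R]_3) : qspace R := (0, v).

Definition qdot (R : realType) (P Q : qspace R) : R :=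
  P.1 * Q.1 + vdot P.2 Q.2.

Definition qwedge_vec (R : realType) (P Q : qspace R) : 'rV[R]_3 :=
  Q.1 *: P.2 + P.1 *: Q.2 + vwedge P.2 Q.2.

Definition qwedge (R : realType) (P Q : qspace R) : qspace R :=
  qscal (qdot P Q) + qvect (qwedge_vec P Q).

Definition qbase (R : realType) (p : 'I_3) : qspace R := qvect (vbase R p).

(* Main.v *)
Require Import Defs.
From mathcomp Require Import all_boot all_order all_algebra.
From mathcomp Require Import all_fingroup.
From mathcomp Require Import reals.

Import GRing.Theory.
Local Open Scope ring_scope.

(** Basis elements have zero scalar part, so the product of two of them is [Delta R p q] plus the
    vector with coordinates [sigma R p q r] ([qwedge_qbase]). In a square the vector part vanishes
    ([sigma_diag]), leaving the scalar -1. For the labels i and j the scalar part vanishes by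
    orthogonality and only the identity permutation contributes ([sigma_ij]), so the product is e_k;
    the triple product is then the square of e_k. *)

Lemma li_neq_lj : li != lj.
Proof. by rewrite -val_eqE /= !inordK. Qed.

Lemma label_cases (r : 'I_3) : [\/ r = li, r = lj | r = lk].
Proof.
by case: r => -[|[|[|//]]] r3; [constructor 1 | constructor 2 | constructor 3];
  apply: val_inj; rewrite /= inordK.
Qed.

(** Stated over any module [W] so that it collapses both the scalar sums of [vdot] (with [R^o]) and
    the vector sums of [vwedge]. *)
Lemma sum_vbase_coef (R : realType) (W : lmodType R) (p : 'I_3)
    (F : 'I_3 -> W) : \sum_x vbase R p 0 x *: F x = F p.
Proof.
rewrite (bigD1 p) //= big1 ?addr0 => [|x xp].
  by rewrite /vbase mxE !eqxx scale1r.
by rewrite /vbase mxE eqxx (negbTE xp) scale0r.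
Qed.

Lemma vdot_vbase (R : realType) (p q : 'I_3) :
  vdot (vbase R p) (vbase R q) = Delta R p q.
Proof.
rewrite /vdot -[RHS](sum_vbase_coef R R^o p (Delta R ^~ q)).
apply: eq_bigr => x _; rewrite -[in RHS](sum_vbase_coef R R^o q (Delta R x)).
by rewrite scaler_sumr; apply: eq_bigr => y _; rewrite -mulrA.
Qed.

Lemma vwedge_vbase (R : realType) (p q : 'I_3) :
  vwedge (vbase R p) (vbase R q) = \sum_r sigma R p q r *: vbase R r.
Proof.
pose F x y := \sum_r sigma R x y r *: vbase R r.
rewrite /vwedge -[RHS](sum_vbase_coef R _ p (F ^~ q)).
apply: eq_bigr => x _; rewrite -[F x q](sum_vbase_coef R _ q (F x)).
by rewrite scaler_sumr; apply: eq_bigr => y _; rewrite scalerA.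
Qed.

(** No map sends one label to both [li] and [lj], so the sum is empty. *)
Lemma sigma_diag (R : realType) (p r : 'I_3) : sigma R p p r = 0.
Proof.
rewrite /sigma big_pred0 // => s; apply/negP => /and3P[/eqP-> ij _].
by rewrite (negbTE li_neq_lj) in ij.
Qed.

(** A permutation of three labels fixing two of them is the identity, which is even and admits only
    [r = lk]. *)
Lemma sigma_ij (R : realType) (r : 'I_3) : sigma R li lj r = (r == lk)%:R.
Proof.
have perm_fix (s : 'S_3) : s li = li -> s lj = lj -> s = 1%g.
  move=> si sj; apply/permP => x; rewrite perm1.
  have [->|->|->] // := label_cases x.
  (* If [s lk] were [li] or [lj], injectivity would identify [lk] with that label, which [s] already
     fixes. *)
  case: (label_cases (s lk)) => // sk.
    have e : lk = li by apply: (@perm_inj _ s); rewrite sk si.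
    by rewrite e si.
  have e : lk = lj by apply: (@perm_inj _ s); rewrite sk sj.
  by rewrite e sj.
rewrite /sigma; have [->|rk] := eqVneq r lk.
  rewrite (big_pred1 (1%g : 'S_3)) ?odd_perm1 // => s.
  apply/and3P/eqP => [[/eqP si /eqP sj _]|->]; first exact: perm_fix.
  by rewrite !perm1.
rewrite big_pred0 // => s; apply/negP => /and3P[/eqP si /eqP sj].
by rewrite (perm_fix s si sj) perm1 (negbTE rk).
Qed.

Lemma qwedge_qbase (R : realType) (p q : 'I_3) :
  qwedge (qbase R p) (qbase R q) =
  qscal (Delta R p q) + qvect (\sum_r sigma R p q r *: vbase R r).
Proof.
rewrite /qwedge /qdot /qwedge_vec /qbase /= vdot_vbase vwedge_vbase.
by rewrite mul0r add0r !scale0r !add0r.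
Qed.

Lemma qwedge_qbase_diag (R : realType) (p : 'I_3) :
  qwedge (qbase R p) (qbase R p) = qscal (- 1 : R).
Proof.
rewrite qwedge_qbase /Delta eqxx big1 ?addr0 // => r _.
by rewrite sigma_diag scale0r.
Qed.

Lemma qwedge_qbase_ij (R : realType) :
  qwedge (qbase R li) (qbase R lj) = qbase R lk.
Proof.
rewrite qwedge_qbase /Delta (negbTE li_neq_lj) add0r (bigD1 lk) //=.
rewrite sigma_ij eqxx scale1r big1 ?addr0 // => r rk.
by rewrite sigma_ij (negbTE rk) scale0r.
Qed.

Theorem mainTheorem1 (R : realType) :
  [/\ qwedge (qbase R li) (qbase R li) = qscal (- 1 : R),
      qwedge (qbase R lj) (qbase R lj) = qscal (- 1 : R),
      qwedge (qbase R lk) (qbase R lk) = qscal (- 1 : R) &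
      qwedge (qwedge (qbase R li) (qbase R lj)) (qbase R lk)
        = qscal (- 1 : R)].
Proof. by rewrite qwedge_qbase_ij !qwedge_qbase_diag. Qed.
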